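(* Let $\delta>0$ and let $f$, $g$, $X$, $\beta$, $B$, $\mathcal{M}$, $L$, $L_\delta$ be as described in the context (in particular the four standing assumptions hold). Let $(\hat{x},\hat{\mu})$ denote a saddle point of the unregularized Lagrangian $L$ over $X\times\mathbb{R}^m_+$, and let $(\hat{x}_\delta,\hat{\mu}_\delta)$ denote the saddle point of $L_\delta$ over $X\times\mathcal{M}$. Then $$\|\hat{x}_\delta-\hat{x}\|^2\le \frac{\delta}{\beta}B^2 .$$ Furthermore, for every $j\in\{1,\dots,m\}$, the possible constraint violation is bounded via $$g_j(\hat{x}_\delta)\le M_j B\sqrt{\frac{\delta}{\beta}},\qquad M_j:=\max_{x\in X}\|\nabla g_j(x)\| .$$
   Context: Problem data: $f:\mathbb{R}^n\to\mathbb{R}$, $g=(g_1,\dots,g_m):\mathbb{R}^n\to\mathbb{R}^m$, $X\subset\mathbb{R}^n$; the underlying problem is to minimize $f(x)$ subject to $g(x)\le 0$ (componentwise) and $x\in X$. $\|\cdot\|$ is the Euclidean norm, $\|\cdot\|_1$ the 1-norm, $\mathbb{R}^m_+$ the non-negative orthant. Standing assumptions: 1. $f$ is twice continuously differentiable and convex. 2. Each $g_j$, $j=1,\dots,m$, is twice continuously differentiable and convex, and Slater's condition holds: there is $\bar{x}\in X$ with $g(\bar{x})<0$ (componentwise). 3. $X$ is non-empty, compact and convex, and $X=X_1\times\cdots\times X_{N_p}$, where $N_p$ is the number of agents optimizing over $x$. 4. (Diagonal dominance) For a constant $\beta>0$, the Hessian $H(x,\mu):=\nabla_x^2L_\delta(x,\mu)$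 satisfies $|H_{ii}|-\beta\ge\sum_{j\ne i}|H_{ij}|$ for all $i=1,\dots,n$, for all $x\in X$ and all $\mu\in\mathcal{M}$. Definitions: the Lagrangian is $L(x,\mu)=f(x)+\mu^Tg(x)$; the dual-regularized Lagrangian is $L_\delta(x,\mu)=f(x)+\mu^Tg(x)-\frac{\delta}{2}\|\mu\|^2$ with regularization parameter $\delta>0$. Set $$B:=\frac{f(\bar{x})-f^*}{\min_{1\le j\le m}-g_j(\bar{x})},\qquad \mathcal{M}:=\{\mu\in\mathbb{R}^m_+:\|\mu\|_1\le B\},$$ where $\bar{x}$ is any Slater point and $f^*$ is the minimum of $f$ over $X$ (without the constraint $g\le 0$), or any lower bound for it. The pair $(\hat{x}_\delta,\hat{\mu}_\delta):=\arg\min_{x\in X}\arg\max_{\mu\in\mathcal{M}}L_\delta(x,\mu)$ is the (unique) saddle point of $L_\delta$; it is also the saddle point of $L_\delta$ over $X\times\mathbb{R}^m_+$. *)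

(* Defs.v *)
From HB Require Import structures.
From mathcomp Require Import all_boot all_order all_algebra.
From mathcomp Require Import all_classical all_reals.
From mathcomp Require Import topology normedtype derive convex.

Set Implicit Arguments.
Unset Strict Implicit.
Unset Printing Implicit Defensive.

Import Order.TTheory GRing.Theory Num.Theory.
Import numFieldNormedType.Exports.

Local Open Scope classical_set_scope.
Local Open Scope ring_scope.

(* The library norm `|v| on 'rV[R]_n is the sup norm, so the Euclidean norm and
   the 1-norm are spelled out; the topology on 'rV[R]_n is the usual one. *)
Definition enorm {R : realType} {n : nat} (v : 'rV[R]_n) : R :=
  Num.sqrt (\sum_(i < n) v 0 i ^+ 2).

Definition norm1 {R : realType} {n : nat} (v : 'rV[R]_n) : R :=
  \sum_(i < n) `|v 0 i|.

Definition is_max {R : realType} (A : set R) (v : R) : Prop :=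
  A v /\ ubound A v.

Definition gradient {R : realType} {n : nat} (h : 'rV[R]_n -> R)
    (x : 'rV[R]_n) : 'rV[R]_n :=
  \row_(i < n) 'D_(delta_mx 0 i) h x.

Definition hessian {R : realType} {n : nat} (h : 'rV[R]_n -> R)
    (x : 'rV[R]_n) : 'M[R]_n :=
  'J (gradient h) x.

Definition twice_continuously_differentiable {R : realType} {n : nat}
    (h : 'rV[R]_n -> R) : Prop :=
  [/\ forall x, differentiable h x,
      forall x, differentiable (gradient h) x
    & continuous (hessian h)].

(* X_1 x ... x X_Np, a point of R^(p_1 + ... + p_Np) being cut into its Np
   consecutive blocks. *)
Definition block_product {R : realType} {Np : nat} {p : 'I_Np -> nat}
    (Xs : forall i, set 'rV[R]_(p i)) : set 'rV[R]_(\sum_(i < Np) p i) :=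
  [set x | forall i, Xs i (submxrow x i)].

Definition nonneg_orthant (R : realType) (m : nat) : set 'rV[R]_m :=
  [set mu | forall j, 0 <= mu 0 j].

Arguments nonneg_orthant R m : clear implicits.

Definition lagrangian {R : realType} {n m : nat} (f : 'rV[R]_n -> R)
    (g : 'rV[R]_n -> 'rV[R]_m) (x : 'rV[R]_n) (mu : 'rV[R]_m) : R :=
  f x + \sum_(j < m) mu 0 j * g x 0 j.

Definition reg_lagrangian {R : realType} {n m : nat} (f : 'rV[R]_n -> R)
    (g : 'rV[R]_n -> 'rV[R]_m) (delta : R)
    (x : 'rV[R]_n) (mu : 'rV[R]_m) : R :=
  lagrangian f g x mu - delta / 2 * enorm mu ^+ 2.

Definition saddle_point {R : realType} {n m : nat}
    (F : 'rV[R]_n -> 'rV[R]_m -> R) (X : set 'rV[R]_n) (Y : set 'rV[R]_m)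
    (x0 : 'rV[R]_n) (mu0 : 'rV[R]_m) : Prop :=
  [/\ X x0, Y mu0,
      forall mu, Y mu -> F x0 mu <= F x0 mu0
    & forall x, X x -> F x0 mu0 <= F x mu0].

(* There are m.+1 >= 1 constraints, so the minimum over them is well defined;
   the index 0 term used as the default value of the iterated minimum is one of
   the terms. *)
Definition dual_bound {R : realType} {n m : nat} (f : 'rV[R]_n -> R)
    (g : 'rV[R]_n -> 'rV[R]_m.+1) (xbar : 'rV[R]_n) (fstar : R) : R :=
  (f xbar - fstar) /
  \big[Num.min/ - g xbar 0 ord0]_(j < m.+1) (- g xbar 0 j).

Definition dual_set {R : realType} {m : nat} (B : R) : set 'rV[R]_m :=
  [set mu | nonneg_orthant R m mu /\ norm1 mu <= B].

Definition diagonally_dominant {R : realType} {n : nat} (beta : R)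
    (H : 'M[R]_n) : Prop :=
  forall i, \sum_(j < n | j != i) `|H i j| <= `|H i i| - beta.

(* Main.v *)
Require Import Defs.
From HB Require Import structures.
From mathcomp Require Import all_boot all_order all_algebra.
From mathcomp Require Import all_classical all_reals.
From mathcomp Require Import topology normedtype landau derive convex.
From mathcomp Require Import interval_inference unstable.
From mathcomp Require Import ring lra.

(** The proof compares the two saddle points by chaining four inequalities.
Write L for the Lagrangian, Ld for its regularization, d for the Euclidean
distance between [xdelta] and [xhat].

Since [xdelta] minimizes Ld(., mudelta) over X and this function is strongly
convex with modulus beta on X, the value at [xhat] exceeds the minimum by at
least beta / 2 * d ^ 2 ([diagonally_dominant_strong_min]).  The other three
inequalities are saddle point inequalities: [mudelta] is the best dual
response to [xdelta] for Ld, hence beats [muhat]; [muhat] is the best dual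
response to [xhat] for L, hence beats [mudelta]; [xhat] minimizes
L(., muhat), hence beats [xdelta].  In the sum of the four all the values of L
cancel and
  beta * d ^ 2 <= delta * (|muhat| ^ 2 - |mudelta| ^ 2)
remains.  The right-hand side is at most delta * B ^ 2, because Slater's
condition forces the 1-norm of the dual part of any saddle point of L, a
fortiori its Euclidean norm, to be at most B ([saddle_point_dual_set]); the
same fact makes [muhat] an admissible competitor of [mudelta].

The constraint violation follows: g_j is convex and g_j(xhat) <= 0, so by the
gradient inequality at [xdelta] and Cauchy-Schwarz, g_j(xdelta) is at most
|grad g_j (xdelta)| * d.

Strong convexity is where the analysis lies.  Along a segment of X with
direction v the second derivative of h = Ld(., mudelta) is the quadratic form
of the Hessian at v.  Row diagonal dominance bounds this form below by
beta * |v| ^ 2 for matrices that are symmetric and have a nonnegative diagonal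
([diagonally_dominant_quad_ge]).  The diagonal is nonnegative by convexity of
h; the symmetry is Schwarz's theorem, proved here in its pointwise form
([derive2_sym]) through second differences. *)

Set Implicit Arguments.
Unset Strict Implicit.
Unset Printing Implicit Defensive.

Import Order.TTheory GRing.Theory Num.Theory.
Import numFieldNormedType.Exports.

Local Open Scope classical_set_scope.
Local Open Scope ring_scope.

(** * Directional derivatives along a line *)

(** The two difference quotients are literally equal.  This
    reduces the mean value arguments to functions of one real variable. *)
Lemma is_derive_line (R : realType) (V W : normedModType R) (h : V -> W)
    (x v : V) (t : R) :
  derivable h (x + t *: v) v ->
  is_derive t 1 (fun s => h (x + s *: v)) ('D_v h (x + t *: v)).
Proof.
have E : (fun s => s^-1 *: (((fun s => h (x + s *: v)) \o shift t) (s *: 1)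
            - h (x + t *: v))) =
    (fun s => s^-1 *: ((h \o shift (x + t *: v)) (s *: v) - h (x + t *: v))).
  apply/funext => s /=; rewrite (_ : s *: 1 + t = s + t); last first.
    by rewrite scaler1.
  by rewrite scalerDl addrCA.
by move=> dh; split; rewrite /derivable /derive E.
Qed.

Lemma line_MVT (R : realType) (V : normedModType R) (h : V -> R) (x v : V)
    (a b : R) :
  a < b -> (forall y, derivable h y v) ->
  exists2 c, a < c < b &
    h (x + b *: v) - h (x + a *: v) = 'D_v h (x + c *: v) * (b - a).
Proof.
move=> ab dh.
have dline t := @is_derive_line _ _ _ _ x v t (dh (x + t *: v)).
have [|c] := @MVT _ _ _ a b ab (fun t _ => dline t).
  by apply: derivable_within_continuous => t _; case: (dline t).
by rewrite in_itv /=; exists c.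
Qed.

(** Only the right-hand limit of the difference quotient is used: points of a
    convex set reached from [x] in the direction [v] have the form
    [x + t *: v] with [t >= 0]. *)
Lemma derive_ge (R : realType) (V : normedModType R) (h : V -> R) (x v : V)
    (c : R) :
  derivable h x v ->
  (forall t, 0 < t < 1 -> h x + t * c <= h (x + t *: v)) -> c <= 'D_v h x.
Proof.
move=> dh hc; rewrite /derive cvg_at_rightE //.
apply: limr_ge.
  by apply/cvg_ex; exists ('D_v h x); apply: cvg_dnbhs_at_right.
near=> t.
have t0 : 0 < t by near: t; exact: nbhs_right_gt.
have t1 : t < 1 by near: t; exact: nbhs_right_lt.
rewrite [_ *: _]mulrC ler_pdivlMr // mulrC /= [t *: v + x]addrC lerBrDl.
by rewrite hc ?t0.
Unshelve. all: by end_near. Qed.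

Lemma derive_le (R : realType) (V : normedModType R) (h : V -> R) (x v : V)
    (c : R) :
  derivable h x v ->
  (forall t, 0 < t < 1 -> h (x + t *: v) <= h x + t * c) -> 'D_v h x <= c.
Proof.
move=> dh hc; rewrite -lerN2 -deriveN //; apply: derive_ge.
  exact: derivableN.
by move=> t t01; rewrite mulrN -opprD lerN2; exact: hc.
Qed.

Lemma differentiable_remainder (R : realType) (V W : normedModType R)
    (F : V -> W) (x : V) (e : R) :
  0 < e -> differentiable F x ->
  exists2 r : R, 0 < r &
    forall k : V, `|k| < r -> `|F (x + k) - F x - 'd F x k| <= e * `|k|.
Proof.
move=> e0 /diff_locally/eqaddoP/(_ _ e0) /nbhs_normP [r /= r0 hr].
exists r => // k kr; have := hr k; rewrite /= sub0r normrN => /(_ kr).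
by rewrite !fctE /= opprD addrA [k + x]addrC.
Qed.

(** * Symmetry of second derivatives *)

(** By the mean value theorem in the direction [u], the second difference is
    [s] times the increment of ['D_u h] between [x + c *: u] and
    [x + s *: v + c *: u] for some [c] in between.  Both points are at distance
    O(s) from [x], so the first-order expansion of ['D_u h] at [x] computes this
    increment up to o(s).  Expanding at [x], instead of using the mean value
    theorem a second time, is what makes differentiability at the single point
    [x] sufficient. *)
Lemma second_difference (R : realType) (V : normedModType R) (h : V -> R)
    (x u v : V) (e : R) :
  0 < e -> (forall y, derivable h y u) ->
  differentiable (fun y => 'D_u h y) x ->
  exists2 r : R, 0 < r & forall s : R, 0 < s < r ->
    `|h (x + s *: v + s *: u) - h (x + s *: u) - h (x + s *: v) + h x
      - s ^+ 2 * 'D_v (fun y => 'D_u h y) x| <= e * s ^+ 2.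
Proof.
move=> e0 dh dF; set F : V -> R := fun y => 'D_u h y.
pose K : R := `|u| + `|v| + 1.
have K0 : 0 < K by rewrite ltr_wpDl // addr_ge0.
(* K s bounds the distance from x to either point of the increment, and each
   of the two expansions receives half of the error. *)
have e'0 : 0 < e / (2 * K) by rewrite divr_gt0 // mulr_gt0.
have [r r0 hr] := @differentiable_remainder _ _ _ F x _ e'0 dF.
exists (r / K) => [|s /andP[s0 sr]]; first by rewrite divr_gt0.
rewrite ltr_pdivlMr // in sr.
pose phi (t : R) : R := h (x + s *: v + t *: u) - h (x + t *: u).
have dphi (t : R) : is_derive t 1 phi (F (x + s *: v + t *: u) - F (x + t *: u)).
  by apply: is_deriveB; exact: is_derive_line.
have [|c /[!in_itv]/= /andP[c0 cs]] := @MVT _ phi _ 0 s s0 (fun t _ => dphi t).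
  by apply: derivable_within_continuous => t _; case: (dphi t).
rewrite /phi !scale0r !addr0 subr0 => E.
have le1 : `|s *: v + c *: u| <= s * K.
  rewrite (le_trans (ler_normD _ _)) // !normrZ !gtr0_norm // /K.
  have : c * `|u| <= s * `|u| by rewrite ler_wpM2r // ltW.
  by move: (normr_ge0 u) (normr_ge0 v); nra.
have le2 : `|c *: u| <= s * K.
  rewrite normrZ gtr0_norm // /K.
  have : c * `|u| <= s * `|u| by rewrite ler_wpM2r // ltW.
  by move: (normr_ge0 u) (normr_ge0 v); nra.
have /(le_trans)/(_ (ler_wpM2l (ltW e'0) le1)) := hr _ (le_lt_trans le1 sr).
have /(le_trans)/(_ (ler_wpM2l (ltW e'0) le2)) := hr _ (le_lt_trans le2 sr).
have Lsum : 'd F x (s *: v + c *: u) = s * 'd F x v + c * 'd F x u.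
  by rewrite linearD !linearZ.
have Lc : 'd F x (c *: u) = c * 'd F x u by rewrite linearZ.
rewrite deriveE // Lsum Lc addrA => h2 h1.
have -> : h (x + s *: v + s *: u) - h (x + s *: u) - h (x + s *: v) + h x
    = h (x + s *: v + s *: u) - h (x + s *: u) - (h (x + s *: v) - h x).
  by ring.
have Ee : e / (2 * K) * (s * K) = e * s / 2 by field; rewrite gt_eqF.
rewrite E; rewrite Ee in h1 h2.
set A := F (x + s *: v + c *: u) in h1 *; set B := F (x + c *: u) in h2 *.
set Du := 'd F x u in h1 h2; set Dv := 'd F x v in h1 *.
rewrite [X in `|X|](_ : _ =
    s * ((A - F x - (s * Dv + c * Du)) - (B - F x - c * Du))).
  rewrite normrM gtr0_norm // expr2 mulrA [leRHS]mulrC ler_pM2l //.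
  by rewrite (le_trans (ler_normB _ _)) // (splitr (e * s)) lerD.
by ring.
Qed.

(** The second difference is symmetric in [u] and [v] and, divided by
    [s ^+ 2], is close to either mixed derivative. *)
Lemma derive2_sym (R : realType) (V : normedModType R) (h : V -> R)
    (x u v : V) :
  (forall y, derivable h y u) -> (forall y, derivable h y v) ->
  differentiable (fun y => 'D_u h y) x ->
  differentiable (fun y => 'D_v h y) x ->
  'D_v (fun y => 'D_u h y) x = 'D_u (fun y => 'D_v h y) x.
Proof.
move=> dhu dhv du dv; apply/eqP; rewrite -subr_eq0 -normr_le0.
apply/ler_addgt0Pl => e e0; rewrite addr0.
have e2 : 0 < e / 2 by rewrite divr_gt0.
have [r r0 hr] := @second_difference _ _ _ x u v _ e2 dhu du.
have [q q0 hq] := @second_difference _ _ _ x v u _ e2 dhv dv.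
pose s := Num.min r q / 2.
have m0 : 0 < Num.min r q by rewrite lt_min r0.
have s0 : 0 < s by rewrite divr_gt0.
have sm : s < Num.min r q by rewrite ltr_pdivrMr // mulr_natr mulr2n ltrDl.
move: (sm); rewrite lt_min => /andP[sr sq].
have := hr s; rewrite s0 sr => /(_ isT).
have := hq s; rewrite s0 sq => /(_ isT).
rewrite [x + s *: u + s *: v]addrAC => h1 h2.
have s20 : 0 < s ^+ 2 by rewrite exprn_gt0.
rewrite -(ler_pM2l s20) -{1}(gtr0_norm s20) -normrM.
move: h1 h2; set p : R := 'D_u _ _; set q' : R := 'D_v _ _.
set a := h (_ + _ + _); set b := h (_ + s *: u); set c := h (_ + s *: v).
move: p q' a b c (h x) (s ^+ 2) => p q' a b c d z h1 h2.
move: h1 h2; rewrite !ler_norml => /andP[h1 h1'] /andP[h2 h2'].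
by apply/andP; split; lra.
Qed.

(** * Gradient and Hessian *)

Lemma derive_gradient (R : realType) (n : nat) (h : 'rV[R]_n -> R)
    (x v : 'rV[R]_n) :
  differentiable h x -> 'D_v h x = \sum_i v 0 i * gradient h x 0 i.
Proof.
move=> dh; rewrite deriveE // {1}[v]row_sum_delta linear_sum.
by apply: eq_bigr => i _; rewrite linearZ mxE deriveE.
Qed.

Lemma differentiable_gradient_coord (R : realType) (n : nat)
    (h : 'rV[R]_n -> R) (x : 'rV[R]_n) (j : 'I_n) :
  differentiable (gradient h) x -> differentiable (fun y => gradient h y 0 j) x.
Proof.
move=> dg; apply: (@differentiable_comp _ _ _ _ (gradient h)
  (fun N : 'rV[R]_n => N 0 j)) => //; exact: differentiable_coord.
Qed.

Lemma derive_gradient_coord (R : realType) (n : nat) (h : 'rV[R]_n -> R)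
    (x v : 'rV[R]_n) (j : 'I_n) :
  differentiable (gradient h) x ->
  'D_v (fun y => gradient h y 0 j) x = \sum_i v 0 i * hessian h x i j.
Proof.
move=> dg; have := derive_mx (diff_derivable (v := v) dg).
rewrite deriveEjacobian // => /rowP/(_ j).
by rewrite !mxE => <-.
Qed.

(** The Jacobian acts on row vectors from the right, so the row index of the
    Hessian is the outer direction of differentiation. *)
Lemma hessianE (R : realType) (n : nat) (h : 'rV[R]_n -> R)
    (x : 'rV[R]_n) (i j : 'I_n) :
  differentiable (gradient h) x ->
  hessian h x i j =
    'D_(delta_mx 0 i) (fun y => 'D_(delta_mx 0 j) h y) x.
Proof.
move=> dg; have := derive_gradient_coord (delta_mx 0 i) j dg.
under [in X in X = _ -> _]eq_fun do rewrite mxE.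
move=> ->; rewrite (bigD1 i) //= big1 => [|k ki]; last first.
  by rewrite mxE eqxx (negPf ki) mul0r.
by rewrite [delta_mx _ _ _ _]mxE !eqxx mul1r addr0.
Qed.

Lemma hessian_sym (R : realType) (n : nat) (h : 'rV[R]_n -> R)
    (x : 'rV[R]_n) (i j : 'I_n) :
  (forall y, differentiable h y) -> differentiable (gradient h) x ->
  hessian h x i j = hessian h x j i.
Proof.
move=> dh dg; rewrite (hessianE i j dg) (hessianE j i dg).
have dD k : differentiable (fun y => 'D_(delta_mx 0 k) h y) x.
  have := differentiable_gradient_coord k dg.
  by under eq_fun do rewrite mxE.
by apply: derive2_sym => // y; exact: diff_derivable.
Qed.

Lemma derive2_hessian (R : realType) (n : nat) (h : 'rV[R]_n -> R)
    (x v : 'rV[R]_n) :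
  (forall y, differentiable h y) -> differentiable (gradient h) x ->
  derivable (fun y => 'D_v h y) x v /\
  'D_v (fun y => 'D_v h y) x =
    \sum_i \sum_j v 0 i * v 0 j * hessian h x i j.
Proof.
move=> dh dg.
have -> : (fun y => 'D_v h y) =
    \sum_(j < n) v 0 j \*: (fun y => gradient h y 0 j : R^o).
  by apply/funext => y; rewrite derive_gradient // fct_sumE.
have dj j : derivable (fun y => gradient h y 0 j : R^o) x v.
  by apply: diff_derivable; exact: differentiable_gradient_coord.
have djZ j : derivable (v 0 j \*: (fun y => gradient h y 0 j : R^o)) x v.
  exact: derivableZ.
split; first exact: derivable_sum.
rewrite derive_sum // exchange_big; apply: eq_bigr => j _ /=.
rewrite deriveZ // derive_gradient_coord // scaler_sumr; apply: eq_bigr => i _.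
by rewrite /GRing.scale /=; ring.
Qed.

(** * Euclidean norm *)

Lemma enorm_sqr (R : realType) (n : nat) (v : 'rV[R]_n) :
  enorm v ^+ 2 = \sum_i v 0 i ^+ 2.
Proof. by rewrite sqr_sqrtr // sumr_ge0 // => i _; rewrite sqr_ge0. Qed.

Lemma enorm_ge0 (R : realType) (n : nat) (v : 'rV[R]_n) : 0 <= enorm v.
Proof. exact: sqrtr_ge0. Qed.

(** Cauchy-Schwarz, from the nonnegativity of the sum of the squares of
    [s * a 0 i - t * b 0 i] at [s = enorm b], [t = enorm a]. *)
Lemma dot_le_enorm (R : realType) (n : nat) (a b : 'rV[R]_n) :
  \sum_i a 0 i * b 0 i <= enorm a * enorm b.
Proof.
have [A0 B0] := (enorm_ge0 a, enorm_ge0 b).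
have dot_sqr_ge0 (s t : R) :
    0 <= s ^+ 2 * enorm a ^+ 2 - 2 * s * t * (\sum_i a 0 i * b 0 i)
         + t ^+ 2 * enorm b ^+ 2.
  have -> : s ^+ 2 * enorm a ^+ 2 - 2 * s * t * (\sum_i a 0 i * b 0 i)
         + t ^+ 2 * enorm b ^+ 2 = \sum_i (s * a 0 i - t * b 0 i) ^+ 2.
    rewrite !enorm_sqr !mulr_sumr -sumrB -big_split; apply: eq_bigr => i _ /=.
    by ring.
  by apply: sumr_ge0 => i _; rewrite sqr_ge0.
have zero (c : 'rV[R]_n) : enorm c = 0 -> forall i, c 0 i = 0.
  move=> c0 i; apply/eqP; rewrite -sqrf_eq0.
  have /eqP := enorm_sqr c; rewrite c0 expr0n eq_sym psumr_eq0 => [/allP|j _].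
    by move=> /(_ i) /=; rewrite mem_index_enum => /(_ isT).
  exact: sqr_ge0.
have [/zero a0|a0] := eqVneq (enorm a) 0.
  by rewrite big1 ?mulr_ge0 // => i _; rewrite a0 mul0r.
have [/zero b0|b0] := eqVneq (enorm b) 0.
  by rewrite big1 ?mulr_ge0 // => i _; rewrite b0 mulr0.
have AB : 0 < enorm a * enorm b by rewrite mulr_gt0 // lt0r ?a0 ?b0.
rewrite -(ler_pM2l AB); have := dot_sqr_ge0 (enorm b) (enorm a).
by move: (\sum_i _) (enorm a) (enorm b) => s p q; lra.
Qed.

Lemma enormN (R : realType) (n : nat) (v : 'rV[R]_n) : enorm (- v) = enorm v.
Proof. by congr Num.sqrt; apply: eq_bigr => i _; rewrite mxE sqrrN. Qed.

Lemma enorm_le_norm1 (R : realType) (n : nat) (v : 'rV[R]_n) :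
  enorm v <= norm1 v.
Proof.
have n0 : 0 <= norm1 v by apply: sumr_ge0.
rewrite -(ler_pXn2r (n := 2)) ?nnegrE ?enorm_ge0 // enorm_sqr.
rewrite [leRHS]expr2 {1}/norm1 mulr_suml; apply: ler_sum => i _.
rewrite -real_normK ?num_real // expr2 ler_wpM2l // /norm1 (bigD1 i) //= lerDl.
exact: sumr_ge0.
Qed.

(** * Convexity and strong convexity *)

Lemma convex_set_line (R : realType) (V : lmodType R) (X : set V) (x y : V)
    (t : R) :
  convex_set X -> X x -> X y -> 0 <= t <= 1 -> X (x + t *: (y - x)).
Proof.
move=> cX Xx Xy /andP[t0 t1].
have := cX y x (Itv01 t0 t1); rewrite !inE => /(_ Xy Xx).
rewrite /conv /= /onem => XE.
rewrite (_ : _ + _ = t *: y + (1 - t) *: x) //.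
by rewrite scalerBr scalerBl scale1r addrC addrAC addrA.
Qed.

Lemma convex_function_line (R : realType) (V : lmodType R) (h : V -> R)
    (x y : V) (t : R) :
  convex_function [set: V] h -> 0 <= t <= 1 ->
  h (x + t *: (y - x)) <= h x + t * (h y - h x).
Proof.
move=> ch /andP[t0 t1].
have := ch (Itv01 t0 t1) y x; rewrite !inE => /(_ I I).
rewrite convRE /conv /= /onem => hE.
rewrite (_ : x + _ = t *: y + (1 - t) *: x).
  by rewrite (le_trans hE) // le_eqVlt; apply/orP; left; apply/eqP; ring.
by rewrite scalerBr scalerBl scale1r [RHS]addrC addrAC addrA.
Qed.

(** Convexity bounds every difference quotient of [h] from [x] towards [y] by
    [h y - h x]. *)
Lemma convex_gradient_ineq (R : realType) (V : normedModType R) (h : V -> R)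
    (x y : V) :
  convex_function [set: V] h -> differentiable h x ->
  h x + 'D_(y - x) h x <= h y.
Proof.
move=> ch dh; rewrite -lerBrDl; apply: derive_le; first exact: diff_derivable.
by move=> t /andP[t0 t1]; apply: convex_function_line; rewrite // !ltW.
Qed.

(** The gradient inequalities at [x] and at [x + t *: v] together show that
    ['D_v h] does not decrease from the first point to the second. *)
Lemma convex_derive2_ge0 (R : realType) (V : normedModType R) (h : V -> R)
    (x v : V) :
  convex_function [set: V] h -> (forall y, differentiable h y) ->
  derivable (fun y => 'D_v h y) x v -> 0 <= 'D_v (fun y => 'D_v h y) x.
Proof.
move=> ch dh dD; apply: derive_ge => // t /andP[t0 _]; rewrite mulr0 addr0.
have := @convex_gradient_ineq _ _ h x (x + t *: v) ch (dh _).
have := @convex_gradient_ineq _ _ h (x + t *: v) x ch (dh _).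
have dZ y : 'D_(t *: v) h y = t * 'D_v h y by rewrite !deriveE ?linearZ.
have dN y : 'D_(- (t *: v)) h y = - (t * 'D_v h y).
  by rewrite -dZ !deriveE ?linearN.
rewrite opprD addNKr dN addrAC subrr add0r dZ => h1 h2.
rewrite -(ler_pM2l t0); lra.
Qed.

(** An off-diagonal term is at least
    [- `|H i j| * (v 0 i ^+ 2 + v 0 j ^+ 2) / 2].  Summing these bounds gives
    half of the row sum and half of the column sum of the off-diagonal absolute
    values as the coefficient of [- v 0 i ^+ 2]; symmetry makes both halves
    equal, so that dominance by rows controls the total. *)
Lemma diagonally_dominant_quad_ge (R : realType) (n : nat) (beta : R)
    (H : 'M[R]_n) (v : 'rV[R]_n) :
  (forall i j, H i j = H j i) -> (forall i, 0 <= H i i) ->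
  diagonally_dominant beta H ->
  beta * enorm v ^+ 2 <= \sum_i \sum_j v 0 i * v 0 j * H i j.
Proof.
move=> Hsym Hdiag Hdom; rewrite enorm_sqr mulr_sumr.
pose off i := \sum_(j < n | j != i) `|H i j| * ((v 0 i ^+ 2 + v 0 j ^+ 2) / 2).
have offE : \sum_i off i = \sum_i \sum_(j < n | j != i) `|H i j| * v 0 i ^+ 2.
  pose P i := \sum_(j < n | j != i) `|H i j| * v 0 i ^+ 2.
  pose Q i := \sum_(j < n | j != i) `|H i j| * v 0 j ^+ 2.
  have PQ : \sum_i P i = \sum_i Q i.
    rewrite /P /Q (exchange_big_dep xpredT) //=; apply: eq_bigr => i _.
    by apply: eq_big => [j|j _]; [rewrite eq_sym | rewrite Hsym].
  have -> : \sum_i off i = (\sum_i P i + \sum_i Q i) / 2.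
    rewrite -big_split mulr_suml; apply: eq_bigr => i _ /=.
    rewrite -big_split mulr_suml; apply: eq_bigr => j _ /=.
    by rewrite -mulrDr mulrA.
  by rewrite -PQ; lra.
apply: (@le_trans _ _ (\sum_i (H i i * v 0 i ^+ 2 - off i))).
  rewrite sumrB offE -sumrB; apply: ler_sum => i _.
  rewrite -mulr_suml -mulrBl ler_wpM2r ?sqr_ge0 //.
  by have := Hdom i; rewrite ger0_norm // lerBrDr lerBrDl addrC.
apply: ler_sum => i _; rewrite (bigD1 i) //= -expr2 mulrC lerD2l.
rewrite -sumrN; apply: ler_sum => j _.
have : `|v 0 i * v 0 j * H i j| <= `|H i j| * ((v 0 i ^+ 2 + v 0 j ^+ 2) / 2).
  rewrite normrM mulrC ler_wpM2l // normrM -[v 0 i ^+ 2]real_normK ?num_real //.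
  rewrite -[v 0 j ^+ 2]real_normK ?num_real //.
  by have := sqr_ge0 (`|v 0 i| - `|v 0 j|); nra.
by rewrite ler_norml => /andP[].
Qed.

(** On the segment from [x] to [y] the second derivative of [h] is at least
    [k = beta * enorm (y - x) ^+ 2] and, [x] being a minimizer, the initial
    slope is nonnegative.  Hence the slope at time [t] is at least [k * t], and
    [h] grows by at least [k / 2] over the unit time interval. *)
Lemma diagonally_dominant_strong_min (R : realType) (n : nat)
    (h : 'rV[R]_n -> R) (X : set 'rV[R]_n) (beta : R) (x y : 'rV[R]_n) :
  (forall z, differentiable h z) ->
  (forall z, differentiable (gradient h) z) ->
  convex_function [set: 'rV[R]_n] h -> convex_set X ->
  (forall z, X z -> diagonally_dominant beta (hessian h z)) ->
  X x -> X y -> (forall z, X z -> h x <= h z) ->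
  h x + beta / 2 * enorm (y - x) ^+ 2 <= h y.
Proof.
move=> dh dg ch cX dom Xx Xy xmin.
set v := y - x; set k := beta * enorm v ^+ 2.
have Xline t : 0 <= t <= 1 -> X (x + t *: v) by exact: convex_set_line.
have curv z : X z -> k <= 'D_v (fun w => 'D_v h w) z.
  move=> Xz; have [_ ->] := derive2_hessian v dh (dg z).
  apply: diagonally_dominant_quad_ge => [i j|i|]; first exact: hessian_sym.
    rewrite hessianE //; apply: convex_derive2_ge0 => //.
    by have [] := derive2_hessian (delta_mx 0 i) dh (dg z).
  exact: dom.
have slope0 : 0 <= 'D_v h x.
  apply: derive_ge => [|t /andP[t0 t1]]; first exact: diff_derivable.
  by rewrite mulr0 addr0; apply/xmin/Xline; rewrite !ltW.
have slope t : 0 < t <= 1 -> k * t <= 'D_v h (x + t *: v).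
  move=> /andP[t0 t1].
  have [|c /andP[c0 ct]] := @line_MVT _ _ (fun w => 'D_v h w) x v _ _ t0.
    by move=> z; have [] := derive2_hessian v dh (dg z).
  rewrite scale0r addr0 subr0 => E.
  rewrite -[leRHS]subr0; apply: (@le_trans _ _ ('D_v h (x + t *: v) - 'D_v h x)).
    rewrite E ler_wpM2r ?(ltW t0) //; apply/curv/Xline.
    by rewrite (ltW c0) ltW // (lt_le_trans ct).
  by rewrite lerD2l lerN2.
pose psi (t : R) : R := h (x + t *: v) - k / 2 * t ^+ 2.
have dpsi (t : R) : is_derive t 1 psi ('D_v h (x + t *: v) - k * t).
  apply: is_deriveB.
    by apply: is_derive_line; exact: diff_derivable.
  apply: is_derive_eq.
  by rewrite /GRing.scale /=; field.
have [|c] := @MVT _ psi _ 0 1 ltr01 (fun t _ => dpsi t).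
  by apply: derivable_within_continuous => t _; case: (dpsi t).
rewrite in_itv /= => /andP[c0 c1].
rewrite /psi scale0r scale1r addr0 subr0 mulr1 expr0n expr1n /= mulr0 subr0.
rewrite mulr1 [x + v]addrC subrK => E.
have : 0 <= 'D_v h (x + c *: v) - k * c by rewrite subr_ge0 slope // c0 ltW.
rewrite -E /k; lra.
Qed.

(** * The regularized Lagrangian *)

Lemma reg_lagrangian_fctE (R : realType) (n m : nat) (f : 'rV[R]_n -> R)
    (g : 'rV[R]_n -> 'rV[R]_m) (delta : R) (mu : 'rV[R]_m) :
  (fun x => reg_lagrangian f g delta x mu) =
  f + \sum_(j < m) mu 0 j \*: (fun x => g x 0 j : R^o)
    + cst (- (delta / 2 * enorm mu ^+ 2)).
Proof. by apply/funext => x; rewrite !fctE fct_sumE. Qed.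

Lemma reg_lagrangian_differentiable (R : realType) (n m : nat)
    (f : 'rV[R]_n -> R) (g : 'rV[R]_n -> 'rV[R]_m) (delta : R)
    (mu : 'rV[R]_m) (x : 'rV[R]_n) :
  differentiable f x -> (forall j, differentiable (fun y => g y 0 j) x) ->
  differentiable (fun y => reg_lagrangian f g delta y mu) x.
Proof.
move=> df dg; rewrite reg_lagrangian_fctE.
apply: differentiableD; last exact: differentiable_cst.
apply: differentiableD => //; apply: differentiable_sum => j.
exact: differentiableZ.
Qed.

Lemma gradient_reg_lagrangian (R : realType) (n m : nat)
    (f : 'rV[R]_n -> R) (g : 'rV[R]_n -> 'rV[R]_m) (delta : R)
    (mu : 'rV[R]_m) :
  (forall x, differentiable f x) ->
  (forall j x, differentiable (fun y => g y 0 j) x) ->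
  gradient (fun y => reg_lagrangian f g delta y mu) =
  gradient f + \sum_(j < m) mu 0 j \*: gradient (fun y => g y 0 j).
Proof.
move=> df dg; apply/funext => x; apply/rowP => i.
rewrite fctE fct_sumE !mxE summxE reg_lagrangian_fctE.
set e := delta_mx 0 i.
have dgx j : derivable (fun y => g y 0 j : R^o) x e := diff_derivable (dg j x).
have dgZ j := derivableZ (k := mu 0 j) (dgx j).
have dfx : derivable f x e := diff_derivable (df x).
have dsum := derivable_sum dgZ.
rewrite (deriveD (derivableD dfx dsum)); last exact: derivable_cst.
rewrite derive_cst addr0 (deriveD dfx dsum) (derive_sum dgZ).
by congr (_ + _); apply: eq_bigr => j _; rewrite (deriveZ _ (dgx j)) !mxE.
Qed.

Lemma differentiable_gradient_reg_lagrangian (R : realType) (n m : nat)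
    (f : 'rV[R]_n -> R) (g : 'rV[R]_n -> 'rV[R]_m) (delta : R)
    (mu : 'rV[R]_m) (x : 'rV[R]_n) :
  (forall y, differentiable f y) ->
  (forall j y, differentiable (fun z => g z 0 j) y) ->
  differentiable (gradient f) x ->
  (forall j, differentiable (gradient (fun y => g y 0 j)) x) ->
  differentiable (gradient (fun y => reg_lagrangian f g delta y mu)) x.
Proof.
move=> df dg dgradf dgradg; rewrite (gradient_reg_lagrangian delta mu df dg).
apply: (differentiableD dgradf); apply: differentiable_sum => j.
exact: (differentiableZ _ (dgradg j)).
Qed.

Lemma reg_lagrangian_convex (R : realType) (n m : nat)
    (f : 'rV[R]_n -> R) (g : 'rV[R]_n -> 'rV[R]_m) (delta : R)
    (mu : 'rV[R]_m) :
  convex_function [set: 'rV[R]_n] f ->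
  (forall j, convex_function [set: 'rV[R]_n] (fun y => g y 0 j)) ->
  nonneg_orthant R m mu ->
  convex_function [set: 'rV[R]_n] (fun y => reg_lagrangian f g delta y mu).
Proof.
move=> cf cg mu0 t x y Ix Iy; have := cf t x y Ix Iy; rewrite !convRE => hf.
set z := conv t x y in hf *.
have hg : \sum_j mu 0 j * g z 0 j <=
    t%:inum * (\sum_j mu 0 j * g x 0 j) + t%:inum.~ * (\sum_j mu 0 j * g y 0 j).
  rewrite !mulr_sumr -big_split; apply: ler_sum => j _ /=.
  have := cg j t x y Ix Iy; rewrite convRE -/z => /(ler_wpM2l (mu0 j)).
  by move/le_trans; apply; rewrite le_eqVlt; apply/orP; left; apply/eqP; ring.
rewrite /reg_lagrangian /lagrangian.
move: hf hg; rewrite /onem; set T := t%:inum; set K := delta / 2 * _.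
lra.
Qed.

(** * Multipliers of the unregularized problem *)

(** If the j-th constraint were violated at [xhat], increasing the j-th
    multiplier would increase the Lagrangian. *)
Lemma saddle_point_feasible (R : realType) (n m : nat) (f : 'rV[R]_n -> R)
    (g : 'rV[R]_n -> 'rV[R]_m) (X : set 'rV[R]_n) (xhat : 'rV[R]_n)
    (muhat : 'rV[R]_m) :
  saddle_point (lagrangian f g) X (nonneg_orthant R m) xhat muhat ->
  forall j, g xhat 0 j <= 0.
Proof.
move=> [_ mu0 mumax _] j.
have /mumax : nonneg_orthant R m (muhat + delta_mx 0 j).
  by move=> k; rewrite !mxE addr_ge0 ?mu0.
rewrite /lagrangian lerD2l.
under eq_bigr do rewrite mxE mulrDl.
rewrite big_split /= -lerBrDl subrr.
rewrite (bigD1 j) //= big1 => [|k kj]; last by rewrite mxE eqxx (negPf kj) mul0r.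
by rewrite mxE !eqxx mul1r addr0.
Qed.

(** The zero multiplier does no better than [muhat], so
    f(xhat) <= L(xhat, muhat) <= L(xbar, muhat), and the last value is at most
    f(xbar) minus [norm1 muhat] times the least slack of the Slater point. *)
Lemma saddle_point_dual_set (R : realType) (n m : nat) (f : 'rV[R]_n -> R)
    (g : 'rV[R]_n -> 'rV[R]_m.+1) (X : set 'rV[R]_n) (fstar : R)
    (xbar xhat : 'rV[R]_n) (muhat : 'rV[R]_m.+1) :
  X xbar -> (forall j, g xbar 0 j < 0) -> (forall x, X x -> fstar <= f x) ->
  saddle_point (lagrangian f g) X (nonneg_orthant R m.+1) xhat muhat ->
  dual_set (dual_bound f g xbar fstar) muhat.
Proof.
move=> Xxbar slater fstar_lb [Xxhat mu0 mumax xmin]; split=> //.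
rewrite /dual_bound; set d := \big[_/_]_(j < _) _.
have d0 : 0 < d by apply/lt_bigmin => [|j _]; rewrite oppr_gt0.
rewrite ler_pdivlMr //.
have hd : norm1 muhat * d <= - \sum_j muhat 0 j * g xbar 0 j.
  rewrite mulr_suml -sumrN; apply: ler_sum => j _.
  by rewrite -mulrN ger0_norm // ler_wpM2l // bigmin_le_cond.
have h0 : 0 <= \sum_j muhat 0 j * g xhat 0 j.
  have /mumax : nonneg_orthant R m.+1 0 by move=> j; rewrite mxE.
  rewrite /lagrangian lerD2l big1 // => j _; by rewrite mxE mul0r.
have := xmin _ Xxbar; have := fstar_lb _ Xxhat; rewrite /lagrangian; lra.
Qed.

(** * The error bound *)

Theorem theorem1 (R : realType) (Np : nat) (p : 'I_Np -> nat) (m : nat)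
    (f : 'rV[R]_(\sum_(i < Np) p i) -> R)
    (g : 'rV[R]_(\sum_(i < Np) p i) -> 'rV[R]_m.+1)
    (Xs : forall i : 'I_Np, set 'rV[R]_(p i))
    (X : set 'rV[R]_(\sum_(i < Np) p i))
    (beta delta fstar B : R)
    (xbar xhat xdelta : 'rV[R]_(\sum_(i < Np) p i))
    (muhat mudelta : 'rV[R]_m.+1)
    (f_C2 : twice_continuously_differentiable f)
    (f_convex : convex_function [set: 'rV[R]_(\sum_(i < Np) p i)] f)
    (g_C2 : forall j, twice_continuously_differentiable (fun x => g x 0 j))
    (g_convex : forall j,
      convex_function [set: 'rV[R]_(\sum_(i < Np) p i)] (fun x => g x 0 j))
    (xbar_X : X xbar)
    (slater : forall j, g xbar 0 j < 0)
    (X_nonempty : X !=set0)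
    (X_compact : compact X)
    (X_convex : convex_set X)
    (X_product : X = block_product Xs)
    (fstar_lb : forall x, X x -> fstar <= f x)
    (B_def : B = dual_bound f g xbar fstar)
    (delta_gt0 : 0 < delta)
    (beta_gt0 : 0 < beta)
    (dominance : forall x (mu : 'rV[R]_m.+1), X x -> dual_set B mu ->
      diagonally_dominant beta
        (hessian (fun y => reg_lagrangian f g delta y mu) x))
    (saddle : saddle_point (lagrangian f g) X (nonneg_orthant R m.+1)
      xhat muhat)
    (saddle_delta : saddle_point (reg_lagrangian f g delta) X
      (dual_set B) xdelta mudelta) :
  enorm (xdelta - xhat) ^+ 2 <= delta / beta * B ^+ 2 /\
  forall (j : 'I_m.+1) (Mj : R),
    is_max [set enorm (gradient (fun y => g y 0 j) x) | x in X] Mj ->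
    g xdelta 0 j <= Mj * B * Num.sqrt (delta / beta).
Proof.
have [Xxhat muhat0 muhat_max xhat_min] := saddle.
have [Xxdelta mudelta_dual mudelta_max xdelta_min] := saddle_delta.
have [mudelta0 _] := mudelta_dual.
have muhat_dual : dual_set B muhat.
  by rewrite B_def; exact: saddle_point_dual_set saddle.
have enorm_muhat : enorm muhat <= B.
  by rewrite (le_trans (enorm_le_norm1 _)) //; case: muhat_dual.
have B0 : 0 <= B by rewrite (le_trans (enorm_ge0 _) enorm_muhat).
have df x : differentiable f x by case: f_C2.
have dgradf x : differentiable (gradient f) x by case: f_C2.
have dg j x : differentiable (fun y => g y 0 j) x by case: (g_C2 j).
have dgradg j x : differentiable (gradient (fun y => g y 0 j)) x.
  by case: (g_C2 j).
have dist_sqr : enorm (xdelta - xhat) ^+ 2 <= delta / beta * B ^+ 2.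
  have growth : reg_lagrangian f g delta xdelta mudelta
      + beta / 2 * enorm (xhat - xdelta) ^+ 2
      <= reg_lagrangian f g delta xhat mudelta.
    apply: (@diagonally_dominant_strong_min _ _
      (fun x => reg_lagrangian f g delta x mudelta) X) => //.
    - by move=> x; exact: reg_lagrangian_differentiable.
    - by move=> x; exact: differentiable_gradient_reg_lagrangian.
    - exact: reg_lagrangian_convex.
    - by move=> x Xx; exact: dominance.
  have muhat_sqr : enorm muhat ^+ 2 <= B ^+ 2.
    by rewrite lerXn2r ?nnegrE ?enorm_ge0.
  have dual_gap : delta * enorm muhat ^+ 2 <= delta * B ^+ 2.
    by rewrite ler_pM2l.
  have mudelta_sqr : 0 <= delta * enorm mudelta ^+ 2.
    by rewrite mulr_ge0 ?sqr_ge0 // ltW.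
  rewrite -enormN opprB mulrAC ler_pdivlMr //.
  move: growth (mudelta_max _ muhat_dual) (muhat_max _ mudelta0)
    (xhat_min _ Xxdelta).
  rewrite /reg_lagrangian; move: dual_gap mudelta_sqr.
  move: (enorm muhat ^+ 2) (enorm mudelta ^+ 2) (enorm (xhat - xdelta) ^+ 2).
  move: (lagrangian f g xhat muhat) (lagrangian f g xhat mudelta).
  move: (lagrangian f g xdelta muhat) (lagrangian f g xdelta mudelta).
  move: (B ^+ 2) => b l1 l2 l3 l4 s t d; lra.
split=> // j Mj [_ Mj_ub].
have dist : enorm (xdelta - xhat) <= B * Num.sqrt (delta / beta).
  have dbeta0 : 0 <= delta / beta by rewrite divr_ge0 ?ltW.
  rewrite -(ler_pXn2r (n := 2)) ?nnegrE ?enorm_ge0 ?mulr_ge0 ?sqrtr_ge0 //.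
  by rewrite exprMn (sqr_sqrtr dbeta0) mulrC.
have grad_le : enorm (gradient (fun y => g y 0 j) xdelta) <= Mj.
  by apply: Mj_ub; exists xdelta.
have g_xhat := saddle_point_feasible saddle j.
have := convex_gradient_ineq xhat (g_convex j) (dg j xdelta).
rewrite (derive_gradient _ (dg j xdelta)) => grad_ineq.
have := dot_le_enorm (xdelta - xhat) (gradient (fun y => g y 0 j) xdelta).
rewrite (_ : \sum_i _ = - \sum_i (xhat - xdelta) 0 i *
    gradient (fun y => g y 0 j) xdelta 0 i); last first.
  by rewrite -sumrN; apply: eq_bigr => i _; rewrite -mulNr !mxE opprB.
move=> cs.
apply: (@le_trans _ _ (enorm (xdelta - xhat)
                       * enorm (gradient (fun y => g y 0 j) xdelta))).
  by move: cs grad_ineq g_xhat; lra.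
rewrite -mulrA mulrC; apply: ler_pM; rewrite ?enorm_ge0 //.
Qed.
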